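(* For any positive numbers $\alpha$ and $\lambda$ there exists a sigmoidal activation function $\sigma:\mathbb{R}\to\mathbb{R}$, $\sigma\in C^\infty(\mathbb{R})$, which is strictly increasing on $(-\infty,\alpha)$, $\lambda$-strictly increasing on $[\alpha,+\infty)$, and satisfies the following property: for any $f\in C([0,1]^d)$ and $\varepsilon>0$ there exist real constants $d_p,c_{pq},\theta_{pq},\gamma_p$ and vectors $\mathbf{w}^{pq}\in\mathbb{R}^d$ ($p=1,\dots,2d+2$, $q=1,\dots,d$) for which $$\left|f(\mathbf{x})-\sum_{p=1}^{2d+2}d_p\,\sigma\left(\sum_{q=1}^dc_{pq}\,\sigma(\mathbf{w}^{pq}\cdot\mathbf{x}-\theta_{pq})-\gamma_p\right)\right|<\varepsilon$$ for all $\mathbf{x}=(x_1,\dots,x_d)\in[0,1]^d$.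
   Context: A function $\sigma:\mathbb{R}\to\mathbb{R}$ is sigmoidal if $\lim_{t\to-\infty}\sigma(t)=0$ and $\lim_{t\to+\infty}\sigma(t)=1$. A real function $g$ on an interval $I$ is $\lambda$-strictly increasing if there is a strictly increasing function $u:I\to\mathbb{R}$ with $|g(x)-u(x)|\le\lambda$ for all $x\in I$. $C([0,1]^d)$ is the set of real continuous functions on the unit cube; $\cdot$ is the standard inner product. *)

(* Defs.v *)
From HB Require Import structures.
From mathcomp Require Import all_boot all_order all_algebra.
From mathcomp Require Import all_classical all_reals all_analysis.
Set Implicit Arguments.
Unset Strict Implicit.
Unset Printing Implicit Defensive.
Import Order.TTheory GRing.Theory Num.Theory.
Import numFieldNormedType.Exports.
Local Open Scope classical_set_scope.
Local Open Scope ring_scope.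

Definition sigmoidal (R : realType) (s : R -> R) : Prop :=
  s t @[t --> -oo] --> (0 : R) /\ s t @[t --> +oo] --> (1 : R).

(* [derive1n] is total, so each iterated derivative is required to be
   differentiable everywhere; together these conditions say that [s] is of
   class C^oo on the whole line. *)
Definition smooth (R : realType) (s : R -> R) : Prop :=
  forall (n : nat) (x : R), derivable (derive1n n s) x 1.

Definition strictly_increasing_on (R : realType) (I : interval R)
    (u : R -> R) : Prop :=
  {in I &, {homo u : x y / x < y}}.

(* Only the values of [g] and [u] on [I] matter. *)
Definition approx_strictly_increasing_on (R : realType) (lam : R)
    (I : interval R) (g : R -> R) : Prop :=
  exists u : R -> R, strictly_increasing_on I u /\
    {in I, forall x, `|g x - u x| <= lam}.

Definition unit_cube (R : realType) (d : nat) : set 'rV[R]_d :=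
  [set x | forall i : 'I_d, 0 <= x ord0 i <= 1].

Definition dotp (R : realType) (d : nat) (w x : 'rV[R]_d) : R :=
  \sum_(i < d) w ord0 i * x ord0 i.

(* Main.v *)
Require Import Defs.
From HB Require Import structures.
From mathcomp Require Import all_boot all_order all_algebra.
From mathcomp Require Import all_classical all_reals all_analysis.
From mathcomp Require Import zify ring lra.
Import Order.TTheory GRing.Theory Num.Theory.
Import numFieldNormedType.Exports.
Local Open Scope classical_set_scope.
Local Open Scope ring_scope.

(** Kolmogorov superposition, in approximate form: if [F] is bounded by [M] on
    the cube, then for any inner functions there are arbitrarily close ones
    which are constant, with separated sums, on the cells of [2d+1] shifted
    grids.  A point lies in cells of at least [d+1] of the grids, so outer
    functions taking the value [F/(d+1)] on the cells, and at most [M/(d+1)]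
    everywhere, leave a residual bounded by [(2d+1)/(2d+2) M].  Applying this
    repeatedly to the residual, with ever smaller perturbations of the
    inner functions, approximates any continuous function.

    The activation function equals [1] plus, on the [n]-th unit interval after
    [alpha], a small multiple of the [n]-th member of a countable family of
    smooth functions which are dense up to affine reparametrisation.  Hence
    every univariate function needed above is, on a segment, uniformly close
    to [a + b sigma(s x - g)].  The inner constants are absorbed into the outer
    thresholds, and the sum of the outer ones is the extra [(2d+2)]-nd unit. *)

(** * Ramps and interpolation *)

(** Global Lipschitz bounds survive sums and compositions and give moduli on the whole line, so the
    superposition argument need not track the range of the inner sums. *)
Definition lip {R : realType} (f : R -> R) : Prop :=
  exists2 L : R, 0 <= L & forall x y, `|f x - f y| <= L * `|x - y|.

Lemma lip_cst {R : realType} (c : R) : lip (fun=> c).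
Proof. by exists 0 => // x y; rewrite subrr normr0 mul0r. Qed.

Lemma lip_affine {R : realType} (a b : R) : lip (fun x => a * x + b).
Proof.
exists `|a| => // x y.
by rewrite (_ : _ - _ = a * (x - y)) ?normrM //; ring.
Qed.

Lemma lipD {R : realType} (f g : R -> R) :
  lip f -> lip g -> lip (fun x => f x + g x).
Proof.
move=> [L L0 fL] [K K0 gK]; exists (L + K); first exact: addr_ge0.
move=> x y; rewrite opprD addrACA mulrDl.
exact: le_trans (ler_normD _ _) (lerD (fL _ _) (gK _ _)).
Qed.

Lemma lip_sum {R : realType} (I : finType) (f : I -> R -> R) :
  (forall i, lip (f i)) -> lip (fun x => \sum_i f i x).
Proof.
move=> fL; elim: (index_enum I) => [|i s IH].
  by under eq_fun do rewrite big_nil; exact: lip_cst.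
by under eq_fun do rewrite big_cons; exact: lipD.
Qed.

Lemma lip_comp {R : realType} (f g : R -> R) :
  lip f -> lip g -> lip (fun x => f (g x)).
Proof.
move=> [L L0 fL] [K K0 gK]; exists (L * K); first exact: mulr_ge0.
by move=> x y; rewrite (le_trans (fL _ _)) // -mulrA ler_wpM2l.
Qed.

Lemma lipZ {R : realType} (a : R) (f : R -> R) : lip f -> lip (fun x => a * f x).
Proof.
move=> /(lip_comp _ _ (lip_affine a 0)).
by under eq_fun do rewrite addr0.
Qed.

(* On each unit interval a ramp rests on an initial plateau of length [m]
   before rising; the plateaux are the cells of a Kolmogorov grid. *)
Record ramp {R : realType} (m : R) (S : R -> R) : Prop := Ramp {
  ramp_homo : {homo S : x y / x <= y};
  ramp0 : forall t, t <= m -> S t = 0;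
  ramp1 : forall t, 1 <= t -> S t = 1 }.

Lemma ramp_itv {R : realType} (m : R) (S : R -> R) t : ramp m S -> 0 <= S t <= 1.
Proof.
move=> rS; apply/andP; split.
  by rewrite -(ramp0 _ _ rS (Num.min t m)) ?ge_min ?lexx ?orbT // (ramp_homo _ _ rS) // ge_min lexx.
by rewrite -(ramp1 _ _ rS (Num.max t 1)) ?le_max ?lexx ?orbT // (ramp_homo _ _ rS) // le_max lexx.
Qed.

Lemma lip_ramp_exists {R : realType} (m : R) : m < 1 ->
  exists2 S : R -> R, ramp m S & lip S.
Proof.
move=> m1; have d0 : 0 < 1 - m by rewrite subr_gt0.
(* [c] projects the line onto the unit segment; an affine map sending [m] to 0 and 1 to 1 will
   precede it. *)
pose c (t : R) := Num.min 1 (Num.max 0 t).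
have cL : lip c.
  exists 1 => // x y; rewrite mul1r /c.
  apply: (@le_trans _ _ `|Num.max 0 x - Num.max 0 y|).
    move: (Num.max _ _) (Num.max _ _) => u v; rewrite ler_norml.
    have := ler_norm (u - v); have := ler_norm (v - u); rewrite distrC.
    move: `|_ - _| => n ? ?.
    by case: (leP 1 u) => ?; case: (leP 1 v) => ?; apply/andP; split; lra.
  rewrite ler_norml.
  have := ler_norm (x - y); have := ler_norm (y - x); rewrite distrC.
  move: `|_ - _| => n ? ?.
  by case: (leP 0 x) => ?; case: (leP 0 y) => ?; apply/andP; split; lra.
exists (fun t => c ((1 - m)^-1 * t + - (m / (1 - m)))); last first.
  exact: lip_comp cL (lip_affine _ _).
have E t : (1 - m)^-1 * t + - (m / (1 - m)) = (t - m) / (1 - m) by ring.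
split => [x y xy|t tm|t t1]; rewrite /c !E.
- rewrite le_min !ge_min lexx /= ge_max !le_max lexx /=.
  by rewrite ler_pM2r ?invr_gt0 // lerD2r xy !orbT.
- by rewrite max_l ?min_r ?ler01 // pmulr_lle0 ?invr_gt0 // subr_le0.
- rewrite min_l // le_max; apply/orP; right.
  by rewrite ler_pdivlMr // mul1r lerD2r.
Qed.

(** For a ramp [S], the increments between consecutive integer shifts act as a partition of unity.
    Weight [k] equals 1 on the plateau that starts at [k + 1], not at [k]. *)
Definition interp {R : realType} (S : R -> R) (N : nat) (s : nat -> R) (t : R) :=
  \sum_(k < N) s k * (S (t - k%:R) - S (t - k.+1%:R)).

Section Interp.
Context {R : realType} (m : R) (S : R -> R) (N : nat) (s : nat -> R) (rS : ramp m S).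

Let weight (k : nat) (t : R) := S (t - k%:R) - S (t - k.+1%:R).

Lemma weight_ge0 k t : 0 <= weight k t.
Proof. by rewrite subr_ge0 (ramp_homo _ _ rS) // lerD2l lerN2 ler_nat. Qed.

Lemma sum_weight t : \sum_(k < N) weight k t = S t - S (t - N%:R).
Proof.
rewrite -(big_mkord xpredT (weight^~ t)) -[LHS]opprK -sumrN.
under eq_bigr do rewrite opprB.
by rewrite telescope_sumr // opprB subr0.
Qed.

Lemma weight_support k t : weight k t != 0 -> k%:R + m < t < k%:R + 2.
Proof.
apply: contraR; rewrite negb_and -!leNgt /weight => /orP[h|h].
  have [h1 h2] : t - k%:R <= m /\ t - k.+1%:R <= m by rewrite -natr1; split; lra.
  by rewrite !(ramp0 _ _ rS) // subrr.
have [h1 h2] : 1 <= t - k%:R /\ 1 <= t - k.+1%:R by rewrite -natr1; split; lra.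
by rewrite !(ramp1 _ _ rS) // subrr.
Qed.

Lemma interp_bound B t : 0 <= B -> (forall k, (k < N)%N -> `|s k| <= B) ->
  `|interp S N s t| <= B.
Proof.
move=> B0 sB; apply: le_trans (ler_norm_sum _ _ _) _.
apply: (@le_trans _ _ (\sum_(k < N) B * weight k t)).
  apply: ler_sum => k _; rewrite normrM [`|_ - _|]ger0_norm ?weight_ge0 //.
  by rewrite ler_wpM2r ?weight_ge0 // sB.
rewrite -mulr_sumr sum_weight ler_piMr //.
by have := ramp_itv _ _ t rS; have := ramp_itv _ _ (t - N%:R) rS; lra.
Qed.

(** On this range the weights sum to 1, so the interpolant is a convex combination of the values
    whose index is active at [t]. *)
Lemma interp_near v e t : 1 <= t <= N%:R + m -> 0 <= e ->
  (forall k, (k < N)%N -> k%:R + m < t < k%:R + 2 -> `|s k - v| <= e) ->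
  `|interp S N s t - v| <= e.
Proof.
move=> /andP[t1 tN] e0 sv.
have W1 : \sum_(k < N) weight k t = 1.
  by rewrite sum_weight (ramp1 _ _ rS) // (ramp0 _ _ rS) ?subr0 //; lra.
have -> : interp S N s t - v = \sum_(k < N) (s k - v) * weight k t.
  by rewrite -[v in LHS]mulr1 -W1 mulr_sumr -sumrB; apply: eq_bigr => k _; rewrite mulrBl.
apply: le_trans (ler_norm_sum _ _ _) _.
apply: (@le_trans _ _ (\sum_(k < N) e * weight k t)); last by rewrite -mulr_sumr W1 mulr1.
apply: ler_sum => k _; rewrite normrM [`|weight _ _|]ger0_norm ?weight_ge0 //.
have [->|w0] := eqVneq (weight k t) 0; first by rewrite !mulr0.
by rewrite ler_wpM2r ?weight_ge0 // sv // weight_support.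
Qed.

Lemma interp_plateau k t : 0 <= m -> (k < N)%N -> k.+1%:R <= t <= k.+1%:R + m ->
  interp S N s t = s k.
Proof.
move=> m0 kN /andP[h1 h2]; apply/eqP; rewrite -subr_eq0 -normr_le0.
have k0 : (0 : R) <= k%:R by [].
have kN' : k.+1%:R <= N%:R :> R by rewrite ler_nat.
(* Used with error 0: on this plateau no weight but the [k]-th is active. *)
apply: interp_near => //.
- by rewrite -natr1 in h1 h2 kN'; apply/andP; split; lra.
- move=> j jN /andP[j1 j2].
  have /eqP -> : j == k.
    rewrite eqn_leq -(ltnS j k) -(ltnS k j) -!(ltr_nat R) -!natr1.
    by rewrite -natr1 in h1 h2; apply/andP; split; lra.
  by rewrite subrr normr0.
Qed.

Lemma interp_out t : t <= m \/ N%:R + 1 <= t -> interp S N s t = 0.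
Proof.
move=> tN; apply: big1 => k _; rewrite -/(weight k t).
have [->|/weight_support] := eqVneq (weight k t) 0; first by rewrite mulr0.
have k0 : (0 : R) <= k%:R by [].
have : k.+1%:R <= N%:R :> R by rewrite ler_nat.
by rewrite -natr1 => ? ?; case: tN; lra.
Qed.

Lemma lip_interp : lip S -> lip (interp S N s).
Proof.
move=> LS; apply: lip_sum => k; apply: lipZ; apply: lipD.
  by have := lip_comp _ _ LS (lip_affine 1 (- k%:R)); under eq_fun do rewrite mul1r.
have := lipZ (-1) _ (lip_comp _ _ LS (lip_affine 1 (- k.+1%:R))).
by under eq_fun do rewrite mulN1r mul1r.
Qed.

End Interp.

(** * Kolmogorov superposition *)

Lemma sum_digits_lt (N d : nat) (k : 'I_d -> 'I_N) :
  (\sum_(q < d) k q * N ^ q < N ^ d)%N.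
Proof.
elim: d k => [|d IH] k; first by rewrite big_ord0 expn0.
rewrite big_ord_recr /= expnS.
have := IH (fun q => k (widen_ord (leqnSn d) q)); have := ltn_ord (k ord_max).
by move: (_ ^ d)%N (\sum_(i < d) _)%N (nat_of_ord _) => a b c; nia.
Qed.

(** Division by [N ^ d] recovers the leading digit; cancelling it leaves the induction
    hypothesis. *)
Lemma sum_digits_inj (N d : nat) (k k' : 'I_d -> 'I_N) :
  (\sum_(q < d) k q * N ^ q = \sum_(q < d) k' q * N ^ q)%N -> k =1 k'.
Proof.
elim: d k k' => [|d IH] k k'; first by move=> _ [].
rewrite !big_ord_recr /= => E q.
pose w (f : 'I_d.+1 -> 'I_N) q := f (widen_ord (leqnSn d) q).
have ltw f := sum_digits_lt N d (w f).
have N0 : (0 < N ^ d)%N by apply: leq_trans (ltw k).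
have Eq : k ord_max = k' ord_max.
  apply/val_inj; have := congr1 (divn^~ (N ^ d)%N) E.
  by rewrite /= ![(\sum_(_ < _) _ + _)%N]addnC !divnMDl // !(divn_small (ltw _)) !addn0.
have Er : w k =1 w k'.
  by apply: IH; move: E; rewrite Eq => /addIn.
case: (unliftP ord_max q) => [j ->|->] //.
by have := Er j; rewrite /w; congr (k _ = k' _); apply/val_inj; rewrite /= /bump leqNgt ltn_ord.
Qed.

(** Reduction modulo [N ^ d] erases the arbitrary part [T] and leaves the digits. *)
Lemma code_inj (N d : nat) (T : 'I_d -> nat -> nat) :
  injective (fun k : {ffun 'I_d -> 'I_N} =>
    ((\sum_q T q (k q)) * N ^ d + \sum_q k q * N ^ q)%N).
Proof.
move=> k k' /(congr1 (modn^~ (N ^ d)%N)) /=.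
rewrite !modnMDl !modn_small ?sum_digits_lt // => E.
by apply/ffunP; exact: sum_digits_inj E.
Qed.

(* The perturbed inner functions take on the [k]-th plateau a value which is a
   multiple of [h] whose base-[N] digits record [k], so that the sum of the
   inner functions determines the cell containing the point. *)
Lemma separate_cells {R : realType} (d K : nat) (m c delta B : R)
    (phi : 'I_d -> R -> R) (s : {ffun 'I_d -> 'I_K.+1} -> R) :
  (0 < K)%N -> 0 <= c <= m -> m < 1 -> 0 < delta -> 0 <= B ->
  (forall q, lip (phi q)) ->
  (forall q x y, `|x - y| <= K%:R^-1 -> `|phi q x - phi q y| <= delta / 2) ->
  (forall k, `|s k| <= B) ->
  exists (psi : 'I_d -> R -> R) (g : R -> R),
    [/\ forall q, lip (psi q),
        forall q x, 0 <= x <= 1 -> `|psi q x - phi q x| <= delta,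
        lip g, forall t, `|g t| <= B &
        forall (k : {ffun 'I_d -> 'I_K.+1}) (x : 'I_d -> R),
          (forall q, (k q)%:R <= K%:R * x q + c <= (k q)%:R + m) ->
          g (\sum_q psi q (x q)) = s k].
Proof.
move=> K0 /andP[c0 cm] m1 d0 B0 phiL phiK sB.
have KR : 0 < K%:R :> R by rewrite ltr0n.
set N := K.+1.
have ND : (0 < N ^ d)%N by rewrite expn_gt0.
have NDR : 0 < (N ^ d)%:R :> R by rewrite ltr0n.
pose rho := delta / 2.
have rho0 : 0 < rho by rewrite divr_gt0.
(* Adding [C q] makes the values nonnegative before they are truncated to naturals. The bound is
   taken on [-1, 1] because a shifted grid may start left of 0. *)
have /choice[C CP] (q : 'I_d) : exists C : R, forall x, `|x| <= 1 -> `|phi q x| <= C.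
  have [L L0 phiLq] := phiL q; exists (`|phi q 0| + L) => x x1.
  rewrite -[phi q x](subrK (phi q 0)) addrC (le_trans (ler_normD _ _)) // lerD2l.
  by rewrite (le_trans (phiLq _ _)) // subr0 ler_piMr.
(* [y k] is the left end of the [k]-th cell. Up to the offset [C q], [v q k] rounds the value there
   down to a multiple of [rho], then adds a fraction of [rho] recording the digit [k] in position
   [q]. *)
pose y (k : nat) := (k%:R - c) / K%:R.
pose T q (k : nat) := Num.truncn ((phi q (y k) + C q) / rho).
pose v q (k : nat) := rho * ((T q k)%:R + (k * N ^ q)%:R / (N ^ d)%:R) - C q.
have vP q k : (k < N)%N -> `|v q k - phi q (y k)| <= rho.
  move=> kN; have yk1 : `|y k| <= 1.
    have kK : k%:R <= K%:R :> R by rewrite ler_nat.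
    have k0 : 0 <= k%:R :> R by [].
    have K1 : 1 <= K%:R :> R by rewrite ler1n.
    by rewrite ler_norml ler_pdivlMr // ler_pdivrMr //; apply/andP; split; lra.
  have : 0 <= (phi q (y k) + C q) / rho.
    apply: divr_ge0; last exact: ltW.
    by have := CP q _ yk1; rewrite ler_norml => /andP[]; lra.
  move=> /truncn_itv /andP[]; rewrite -/(T q k) -natr1 ler_pdivlMr // ltr_pdivrMr // => t1 t2.
  have : (k * N ^ q)%:R / (N ^ d)%:R <= 1 :> R.
    rewrite ler_pdivrMr // mul1r ler_nat.
    apply: leq_trans (leq_pexp2l (ltn0Sn K) (ltn_ord q)).
    by rewrite expnS leq_mul2r (ltnW kN) orbT.
  have : 0 <= (k * N ^ q)%:R / (N ^ d)%:R :> R by [].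
  rewrite /v; move: (_ / _) => z z0 z1; rewrite ler_norml.
  have : 0 <= rho * z by rewrite mulr_ge0 // ltW.
  have : rho * z <= rho by rewrite ler_piMr // ltW.
  by rewrite mulrDr; move: (rho * z) => w ? ?; apply/andP; split; lra.
have [S rS LS] := lip_ramp_exists m m1.
have [S0 rS0 LS0] := lip_ramp_exists (0 : R) ltr01.
pose code (k : {ffun 'I_d -> 'I_N}) :=
  ((\sum_q T q (k q)) * N ^ d + \sum_q k q * N ^ q)%N.
pose h := rho / (N ^ d)%:R.
have h0 : 0 < h by rewrite divr_gt0.
pose M := (\max_k code k).+1.
(* Numbers that code no cell get the value 0, which respects the bound [B]. *)
pose s' n := if [pick k | code k == n] is Some k then s k else 0.
have s'P k : s' (code k) = s k.
  rewrite /s'; case: pickP => [k' /eqP /code_inj -> //|/(_ k)].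
  by rewrite eqxx.
(* The 1 in both shifts compensates for plateau [k] starting at [k + 1]. The outer argument hits
   integers exactly, so plateaux of length 0 suffice there. *)
exists (fun q x => interp S N (v q) (K%:R * x + (1 + c))),
  (fun t => interp S0 M s' (h^-1 * t + (h^-1 * (\sum_q C q) + 1))); split.
- by move=> q; apply: lip_comp (lip_interp _ _ _ LS) (lip_affine _ _).
- move=> q x /andP[x0 x1]; apply: (interp_near _ _ _ _ rS) => //.
  + have : 0 <= K%:R * x by rewrite mulr_ge0.
    have : K%:R * x <= K%:R by rewrite ler_piMr.
    by rewrite /N -natr1; move: (_ * x) => z ? ?; apply/andP; split; lra.
  + exact: ltW.
  + move=> k kN /andP[k1 k2].
    rewrite -[v q k](subrK (phi q (y k))) -addrA (le_trans (ler_normD _ _)) //.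
    rewrite [leRHS]splitr lerD ?vP // phiK //.
    have -> : y k - x = (k%:R + 1 - (K%:R * x + (1 + c))) / K%:R.
      by rewrite /y; field; rewrite gt_eqF.
    rewrite normrM [`|K%:R^-1|]ger0_norm // ler_piMl //.
    by rewrite ler_norml; move: (_ * x) k1 k2 => z ? ?; apply/andP; split; lra.
- by apply: lip_comp (lip_interp _ _ _ LS0) (lip_affine _ _).
- move=> t; apply: (interp_bound _ _ _ _ rS0) => // n _.
  by rewrite /s'; case: pickP => [k _|_]; rewrite ?normr0.
- move=> k x kx.
  have -> : \sum_q interp S N (v q) (K%:R * x q + (1 + c)) = \sum_q v q (k q).
    apply: eq_bigr => q _; apply: (interp_plateau _ _ _ _ rS) => //.
      exact: le_trans cm.
    by have /andP[] := kx q; rewrite -natr1 => ? ?; apply/andP; split; lra.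
  have -> : \sum_q v q (k q) = h * (code k)%:R - \sum_q C q.
    rewrite sumrB; congr (_ - _).
    rewrite -mulr_sumr big_split /= -mulr_suml /code natrD natrM !natr_sum /h.
    by field; rewrite gt_eqF.
  have -> : h^-1 * (h * (code k)%:R - \sum_q C q) + (h^-1 * (\sum_q C q) + 1) =
      (code k).+1%:R.
    by rewrite -natr1; field; rewrite gt_eqF.
  rewrite -s'P; apply: (interp_plateau _ _ _ _ rS0) => //.
    by rewrite /M ltnS leq_bigmax.
  by rewrite addr0 lexx.
Qed.

Definition cube_ucont {R : realType} {d : nat} (F : 'rV[R]_d -> R) : Prop :=
  forall e : R, 0 < e -> exists2 eta : R, 0 < eta &
    forall x y : 'rV[R]_d, unit_cube x -> unit_cube y ->
      (forall q, `|x ord0 q - y ord0 q| <= eta) -> `|F x - F y| <= e.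

(* For each coordinate at most one of the [2d+1] shifted grids has its gap at
   that coordinate, so at most [d] grids miss a given point. *)
Lemma few_bad_grids (d : nat) (n : 'I_d -> nat) :
  (#|[pred p : 'I_(2 * d).+1 | [exists q, (n q + p) %% (2 * d).+1 == 2 * d]]| <= d)%N.
Proof.
(* [f q] is the only shift whose gap meets coordinate [q]. *)
pose f (q : 'I_d) : 'I_(2 * d).+1 := inord (2 * d - n q %% (2 * d).+1).
apply: (@leq_trans #|codom f|); last first.
  by rewrite (leq_trans (card_size _)) // size_codom card_ord.
apply/subset_leq_card/fintype.subsetP => p; rewrite inE => /existsP[q /eqP E].
apply/codomP; exists q; apply/val_inj; rewrite /f /= inordK; last by lia.
have := ltn_ord p; have : (n q %% (2 * d).+1 < (2 * d).+1)%N by rewrite ltn_mod.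
move: E; rewrite -modnDml; move: (n q %% _)%N (nat_of_ord p) => a b E aP bP; move: E.
have [ab|ab] := ltnP (a + b) (2 * d).+1; first by rewrite modn_small //; lia.
by rewrite -(subnK ab) modnDr modn_small; lia.
Qed.

(** [n] indexes the fine interval of length [1 / (K P)] containing [x]. A cell of grid [p] is made
    of [2d] consecutive fine intervals; the gap after it is a single one, of residue [2d]. *)
Lemma grid_cell {R : realType} (d K p : nat) (x : R) (P := (2 * d).+1)
    (n := Num.truncn (K%:R * P%:R * x)) : 0 <= x <= 1 -> (p < P)%N ->
  ((n + p) %% P != 2 * d)%N ->
  ((n + p) %/ P < K.+1)%N /\
  ((n + p) %/ P)%N%:R <= K%:R * x + p%:R / P%:R <=
    ((n + p) %/ P)%N%:R + (2 * d)%:R / P%:R.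
Proof.
move=> /andP[x0 x1] pP np.
have PR : 0 < P%:R :> R by rewrite ltr0n.
have KP : 0 <= K%:R * P%:R * x by rewrite !mulr_ge0.
have /andP[n1 n2] := truncn_itv KP; rewrite -/n in n1 n2.
have nK : (n <= K * P)%N.
  by rewrite -(ler_nat R) (le_trans n1) // natrM ler_piMr // mulr_ge0.
have r_lt : ((n + p) %% P < 2 * d)%N.
  by have := ltn_pmod (n + p) (ltn0Sn (2 * d)); rewrite ltnS leq_eqVlt (negPf np).
have E := divn_eq (n + p) P; split.
  rewrite ltn_divLR //; first by move: nK pP; rewrite /P; nia.
move: ((n + p) %/ P)%N ((n + p) %% P)%N E r_lt => a r E r_lt.
have E' : n%:R + p%:R = a%:R * P%:R + r%:R :> R by rewrite -natrM -!natrD E.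
have r1 : r%:R + 1 <= (2 * d)%:R :> R by rewrite natr1 ler_nat.
have r0 : 0 <= r%:R :> R by [].
have -> : K%:R * x + p%:R / P%:R = (K%:R * P%:R * x + p%:R) / P%:R.
  by field; rewrite gt_eqF.
have -> : a%:R + (2 * d)%:R / P%:R = (a%:R * P%:R + (2 * d)%:R) / P%:R :> R.
  by field; rewrite gt_eqF.
rewrite ler_pM2r ?invr_gt0 // ler_pdivlMr //.
by rewrite -natr1 in n2; apply/andP; split; lra.
Qed.

(** Clipping the left end of a cell at 0 brings it into the cube and, as [x] is nonnegative, never
    moves it away from [x]. *)
Lemma cell_point_near {R : realType} (K k x c m : R) :
  0 < K -> m <= 1 -> 0 <= x -> k <= K * x + c <= k + m ->
  `|Num.max 0 ((k - c) / K) - x| <= K^-1.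
Proof.
move=> K0 m1 x0 /andP[k1 k2].
have yx : (k - c) / K <= x by rewrite ler_pdivrMr //; lra.
have xy : x <= (k - c) / K + K^-1.
  by rewrite -{2}[K^-1]mul1r -mulrDl ler_pdivlMr //; lra.
have : 0 < K^-1 by rewrite invr_gt0.
move: (K^-1) ((k - c) / K) yx xy => h y yx xy h0; rewrite ler_norml.
by case: (leP 0 y) => ?; apply/andP; split; lra.
Qed.

Lemma kolmogorov_step {R : realType} (d : nat)
    (phi : 'I_(2 * d).+1 -> 'I_d -> R -> R) (F : 'rV[R]_d -> R) (M delta : R) :
  0 < M -> (forall x, unit_cube x -> `|F x| <= M) -> cube_ucont F ->
  (forall p q, lip (phi p q)) -> 0 < delta ->
  exists (psi : 'I_(2 * d).+1 -> 'I_d -> R -> R) (g : 'I_(2 * d).+1 -> R -> R),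
    [/\ forall p q, lip (psi p q),
        forall p q x, 0 <= x <= 1 -> `|psi p q x - phi p q x| <= delta,
        forall p, lip (g p) &
        forall x, unit_cube x ->
          `|F x - \sum_p g p (\sum_q psi p q (x ord0 q))| <=
            (2 * d%:R + 1) / (2 * d%:R + 2) * M].
Proof.
move=> M0 FM Fu phiL delta0.
set P := (2 * d).+1; pose D : R := d.+1%:R.
have D0 : 0 < D by rewrite ltr0n.
have PR : 0 < P%:R :> R by rewrite ltr0n.
pose m : R := (2 * d)%:R / P%:R.
have m1 : m < 1 by rewrite ltr_pdivrMr // mul1r ltr_nat.
(* Errors [e / D] on [P] grids add up to [M / (2 D)]; together with [d M / D] this is exactly the
   contracted bound. *)
pose e := M / (2 * P%:R).
have e0 : 0 < e by rewrite divr_gt0 // mulr_gt0.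
have [eta eta0 Feta] := Fu _ e0.
have /choice[L LP] (pq : 'I_P * 'I_d) : exists L : R, 0 <= L /\
    forall x y, `|phi pq.1 pq.2 x - phi pq.1 pq.2 y| <= L * `|x - y|.
  by have [L L0 HL] := phiL pq.1 pq.2; exists L.
(* [K] makes [1 / K] at most [eta], and the oscillation of every inner function over that length at
   most [delta / 2]; the sum of the Lipschitz constants dominates each of them. *)
pose K := (Num.truncn (eta^-1 + (\sum_pq L pq) / (delta / 2))).+1.
have K0 : (0 < K)%N by [].
have KR : 0 < K%:R :> R by rewrite ltr0n.
have sL0 : 0 <= \sum_pq L pq by apply: sumr_ge0 => pq _; have [] := LP pq.
have Kgt : eta^-1 + (\sum_pq L pq) / (delta / 2) < K%:R by exact: truncnS_gt.
have Keta : K%:R^-1 <= eta.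
  rewrite -[eta]invrK lef_pV2 ?posrE ?invr_gt0 //.
  by rewrite (le_trans _ (ltW Kgt)) // lerDl divr_ge0 // ltW // divr_gt0.
have KL p q x y : `|x - y| <= K%:R^-1 -> `|phi p q x - phi p q y| <= delta / 2.
  move=> xy; have [L0 /(_ x y)/= HL] := LP (p, q); rewrite (le_trans HL) //.
  apply: (@le_trans _ _ ((\sum_pq L pq) * K%:R^-1)).
    apply: ler_pM => //; rewrite (bigD1 (p, q)) //= lerDl.
    by apply: sumr_ge0 => pq _; have [] := LP pq.
  rewrite ler_pdivrMr // mulrC -ler_pdivrMr ?divr_gt0 //.
  by rewrite (le_trans _ (ltW Kgt)) // lerDr invr_ge0 ltW.
pose c (p : 'I_P) : R := p%:R / P%:R.
have cm p : 0 <= c p <= m.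
  by rewrite divr_ge0 // ler_pM2r ?invr_gt0 // ler_nat -ltnS ltn_ord.
pose point p (k : {ffun 'I_d -> 'I_K.+1}) : 'rV[R]_d :=
  \row_q Num.max 0 (((k q)%:R - c p) / K%:R).
have pointP p k : unit_cube (point p k).
  move=> q; rewrite mxE le_max lexx /= ge_max ler01 /=.
  rewrite ler_pdivrMr // mul1r lerBlDr (@le_trans _ _ K%:R) //.
    by rewrite ler_nat -ltnS ltn_ord.
  by rewrite lerDl; have /andP[] := cm p.
have B0 : 0 <= M / D by rewrite divr_ge0 ?ltW.
have /choice[h hP] (p : 'I_P) := separate_cells _ _ _ _ _ _ (phi p)
  (fun k => F (point p k) / D) K0 (cm p) m1 delta0 B0 (phiL p) (KL p)
  (fun k => ltac:(rewrite normrM [`|D^-1|]gtr0_norm ?invr_gt0 // ler_pM2r ?invr_gt0 // FM //)).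
have {hP}/choice[g gP] := hP.
exists h, g; split=> [p q|p q x x01|p|x x01].
- by have [] := gP p.
- by have [_ /(_ q x x01)] := gP p.
- by have [] := gP p.
set G := fun p => g p (\sum_q h p q (x ord0 q)).
pose n q := Num.truncn (K%:R * P%:R * x ord0 q).
pose bad := [pred p : 'I_P | [exists q, ((n q + p) %% P == 2 * d)%N]].
have good p : ~~ bad p -> `|G p - F x / D| <= e / D.
  rewrite negb_exists => /forallP np.
  have kP q := grid_cell _ _ _ _ (x01 q) (ltn_ord p) (np q).
  pose k : {ffun 'I_d -> 'I_K.+1} := [ffun q => Ordinal (kP q).1].
  have kq q : (k q)%:R <= K%:R * x ord0 q + c p <= (k q)%:R + m.
    by rewrite ffunE; have [_] := kP q.
  have [_ _ _ _ /(_ k (fun q => x ord0 q) kq) GE] := gP p.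
  rewrite /G GE -mulrBl normrM [`|D^-1|]gtr0_norm ?invr_gt0 //.
  rewrite ler_pM2r ?invr_gt0 // Feta // => q; rewrite (le_trans _ Keta) //.
  rewrite mxE (cell_point_near _ _ _ (c p) m) ?(ltW m1) //.
  by have /andP[] := x01 q.
pose b : R := #|bad|%:R.
have b_le : b <= d%:R by rewrite ler_nat; exact: few_bad_grids.
(* The deviation from the intended value, which is [F x / D] on a good grid and 0 on a bad one. *)
pose H p := G p - (F x / D - (if bad p then F x / D else 0)).
have HP p : `|H p| <= (if bad p then M / D else 0) + e / D.
  rewrite /H; case: ifPn => [_|/good]; last by rewrite subr0 add0r.
  rewrite subrr subr0; have [_ _ _ /(_ (\sum_q h p q (x ord0 q)))] := gP p.
  by move=> /le_trans -> //; rewrite lerDl divr_ge0 // ltW.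
have -> : \sum_p G p = \sum_p H p + (P%:R - b) * (F x / D).
  apply/eqP; rewrite addrC -subr_eq -sumrB; apply/eqP.
  under eq_bigr do rewrite opprB addrC subrK.
  by rewrite sumrB -big_mkcond /= !sumr_const card_ord -!(mulr_natl (F x / D)) mulrBl.
rewrite opprD addrA addrAC (le_trans (ler_normB _ _)) //.
have HS : `|\sum_p H p| <= b * (M / D) + P%:R * (e / D).
  rewrite (le_trans (ler_norm_sum _ _ _)) // (le_trans (ler_sum _ (fun p _ => HP p))) //.
  by rewrite big_split /= -big_mkcond /= !sumr_const card_ord
    -(mulr_natl (M / D)) -(mulr_natl (e / D)).
have DE : D = d%:R + 1 by rewrite /D natr1.
have PE : P%:R = 2 * d%:R + 1 :> R by rewrite /P -natr1 natrM.
(* The intended values sum to [F x] up to [(d - b) / D] times [|F x|]. The coefficient is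
   nonnegative since [b <= d], and the terms in [b] cancel in the total bound. *)
have -> : F x - (P%:R - b) * (F x / D) = (d%:R - b) / D * - F x.
  by rewrite PE DE; field; rewrite -DE gt_eqF.
have -> : (2 * d%:R + 1) / (2 * d%:R + 2) * M =
    (d%:R - b) / D * M + (b * (M / D) + P%:R * (e / D)).
  rewrite /e PE DE; field.
  by rewrite -PE -DE !gt_eqF // (_ : _ + 2 = 2 * D) ?mulr_gt0 // DE; ring.
apply: lerD _ HS; rewrite normrM normrN ger0_norm ?divr_ge0 ?subr_ge0 ?(ltW D0) //.
by rewrite ler_wpM2l ?FM // divr_ge0 ?subr_ge0 // (ltW D0).
Qed.

Definition superposition {R : realType} {P d : nat} (psi : 'I_P -> 'I_d -> R -> R)
    (g : 'I_P -> R -> R) (x : 'rV[R]_d) : R :=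
  \sum_p g p (\sum_q psi p q (x ord0 q)).

(** [delta] is chosen before the inner values, so they may afterwards be perturbed or replaced by
    network units. *)
Lemma superposition_near {R : realType} (P d : nat) (g : 'I_P -> R -> R) (e : R) :
  (forall p, lip (g p)) -> 0 < e ->
  exists2 delta : R, 0 < delta & forall u v : 'I_P -> 'I_d -> R,
    (forall p q, `|u p q - v p q| <= delta) ->
    `|\sum_p g p (\sum_q u p q) - \sum_p g p (\sum_q v p q)| <= e.
Proof.
move=> gL e0.
have /choice[L LP] (p : 'I_P) : exists L : R, 0 <= L /\
    forall x y, `|g p x - g p y| <= L * `|x - y|.
  by have [L L0 HL] := gL p; exists L.
pose C := \sum_p L p * d%:R + 1.
have C0 : 0 < C.
  by rewrite ltr_wpDl // sumr_ge0 // => p _; rewrite mulr_ge0 //; have [] := LP p.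
exists (e / C) => [|u v uv]; first exact: divr_gt0.
rewrite -sumrB (le_trans (ler_norm_sum _ _ _)) //.
apply: (@le_trans _ _ (\sum_p L p * d%:R * (e / C))).
  apply: ler_sum => p _; have [L0 /(_ _ _)/le_trans -> //] := LP p.
  rewrite -mulrA ler_wpM2l // -sumrB (le_trans (ler_norm_sum _ _ _)) //.
  rewrite (le_trans (ler_sum _ (fun q _ => uv p q))) //.
  by rewrite sumr_const card_ord mulr_natl.
rewrite -mulr_suml mulrCA ger_pMr // ler_pdivrMr // mul1r.
by rewrite /C lerDl.
Qed.

(** Ensures that the residual of one round is an admissible target for the next. *)
Lemma superposition_ucont {R : realType} (P d : nat)
    (psi : 'I_P -> 'I_d -> R -> R) (g : 'I_P -> R -> R) :
  (forall p q, lip (psi p q)) -> (forall p, lip (g p)) ->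
  cube_ucont (superposition psi g).
Proof.
move=> psiL gL e e0; have [delta d0 H] := superposition_near P d _ _ gL e0.
have /choice[L LP] (pq : 'I_P * 'I_d) : exists L : R, 0 <= L /\
    forall x y, `|psi pq.1 pq.2 x - psi pq.1 pq.2 y| <= L * `|x - y|.
  by have [L L0 HL] := psiL pq.1 pq.2; exists L.
pose C := \sum_pq L pq + 1.
have L0 pq : 0 <= L pq by have [] := LP pq.
have C0 : 0 < C by rewrite ltr_wpDl // sumr_ge0.
exists (delta / C) => [|x y _ _ xy]; first exact: divr_gt0.
apply: (H (fun p q => psi p q (x ord0 q)) (fun p q => psi p q (y ord0 q))) => p q.
have [_ /(_ _ _)/le_trans -> //] := LP (p, q).
rewrite (le_trans (ler_wpM2l (L0 _) (xy q))) //.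
rewrite mulrCA ger_pMr // ler_pdivrMr // mul1r /C (bigD1 (p, q)) //= -addrA.
by rewrite lerDl addr_ge0 // sumr_ge0.
Qed.

Lemma cube_ucontB {R : realType} (d : nat) (F G : 'rV[R]_d -> R) :
  cube_ucont F -> cube_ucont G -> cube_ucont (fun x => F x - G x).
Proof.
move=> Fu Gu e e0; have e20 : 0 < e / 2 by rewrite divr_gt0.
have [a a0 Fa] := Fu _ e20; have [b b0 Gb] := Gu _ e20.
exists (Num.min a b) => [|x y xc yc xy]; first by rewrite lt_min a0.
have xya q : `|x ord0 q - y ord0 q| <= a by rewrite (le_trans (xy q)) // ge_min lexx.
have xyb q : `|x ord0 q - y ord0 q| <= b by rewrite (le_trans (xy q)) // ge_min lexx orbT.
rewrite (_ : _ - _ = (F x - F y) - (G x - G y)); last by ring.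
by rewrite (le_trans (ler_normB _ _)) // [leRHS]splitr lerD ?Fa ?Gb.
Qed.

(* The inner functions are perturbed at each round by so little that the
   approximation already obtained survives. *)
Lemma kolmogorov_approx {R : realType} (d : nat) (f : 'rV[R]_d -> R) (M eps : R) :
  cube_ucont f -> (forall x, unit_cube x -> `|f x| <= M) -> 0 < eps ->
  exists (psi : 'I_(2 * d).+1 -> 'I_d -> R -> R) (g : 'I_(2 * d).+1 -> R -> R),
    [/\ forall p q, lip (psi p q), forall p, lip (g p) &
        forall x, unit_cube x -> `|f x - superposition psi g x| <= eps].
Proof.
move=> fu fM eps0.
wlog M0 : M fM / 0 < M.
  move=> /(_ (`|M| + 1)); apply=> [x /fM fx|]; last by rewrite ltr_wpDl.
  by rewrite (le_trans fx) // ler_wpDr // ler_norm.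
pose theta : R := (2 * d%:R + 1) / (2 * d%:R + 2).
(* A rate strictly between [theta] and 1: the slack [t - theta] pays for perturbing the inner
   functions. *)
pose t : R := (1 + theta) / 2.
have d0 : 0 <= d%:R :> R by [].
have th1 : theta < 1 by rewrite ltr_pdivrMr; lra.
have th0 : 0 < theta by rewrite divr_gt0; lra.
have t0 : 0 < t by rewrite /t; lra.
have t1 : t < 1 by rewrite /t; lra.
have tth : 0 < t - theta by rewrite /t; lra.
have main n : exists (psi : 'I_(2 * d).+1 -> 'I_d -> R -> R) (g : 'I_(2 * d).+1 -> R -> R),
    [/\ forall p q, lip (psi p q), forall p, lip (g p) &
        forall x, unit_cube x -> `|f x - superposition psi g x| <= t ^+ n * M].
  elim: n => [|n [psi [g [psiL gL H]]]].
    exists (fun _ _ => fun=> 0), (fun _ => fun=> 0).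
    split=> [p q|p|x /fM]; try exact: lip_cst.
    by rewrite /superposition sumr_const mul0rn subr0 expr0 mul1r.
  have Mn0 : 0 < t ^+ n * M by rewrite mulr_gt0 // exprn_gt0.
  have Fu := cube_ucontB _ _ _ fu (superposition_ucont _ _ _ _ psiL gL).
  have e0 : 0 < (t - theta) * (t ^+ n * M) by rewrite mulr_gt0.
  have [delta delta0 gd] := superposition_near _ d g _ gL e0.
  have [psi' [h [psiL' psid hL H']]] := kolmogorov_step _ psi _ _ _ Mn0 H Fu psiL delta0.
  exists psi', (fun p x => g p x + h p x); split=> // [p|x xc]; first exact: lipD.
  (* The old residual after one step, minus the change that the new inner functions cause in the old
     superposition. *)
  rewrite (_ : _ - _ = (f x - superposition psi g x - superposition psi' h x) -
     (superposition psi' g x - superposition psi g x)); last first.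
    rewrite /superposition big_split /=; ring.
  rewrite (le_trans (ler_normB _ _)) //.
  rewrite (_ : _ * M = theta * (t ^+ n * M) + (t - theta) * (t ^+ n * M)); last first.
    by rewrite exprS; ring.
  apply: lerD; first exact: H'.
  by apply: gd => p q; exact: psid.
have : GRing.exp t n @[n --> \oo] --> (0 : R) by apply: cvg_expr; rewrite gtr0_norm.
move=> /cvgrPdist_lt /(_ (eps / M)); rewrite divr_gt0 // => /(_ isT) [n _ /(_ n)/= hn].
have [psi [g [psiL gL H]]] := main n; exists psi, g; split=> // x /H /le_trans; apply.
rewrite -ler_pdivlMr //; have := hn (leqnn n).
by rewrite sub0r normrN ger0_norm ?exprn_ge0 ?(ltW t0) // => /ltW.
Qed.

(** * Compactness of the cube: uniform continuity and boundedness *)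

Lemma compact_unit_cube {R : realType} (d : nat) : compact (@unit_cube R d).
Proof.
have := @rV_compact R d (fun=> `[0, 1]%classic) (fun=> @segment_compact R 0 1).
by congr (compact _); apply/seteqP; split=> x /= xc i; have := xc i; rewrite /= in_itv.
Qed.

(** Heine-Cantor through the covering form of compactness: the estimate [Q] is proved near each
    point of the cube for all small [eta]. *)
Lemma cube_continuous_ucont {R : realType} (d : nat) (f : 'rV[R]_d -> R) :
  {within @unit_cube R d, continuous f} -> cube_ucont f.
Proof.
move=> /subspace_continuousP fc e e0.
have e20 : 0 < e / 2 by rewrite divr_gt0.
pose Q (eta : R) (x : 'rV[R]_d) := unit_cube x -> forall y, unit_cube y ->
   (forall q, `|x ord0 q - y ord0 q| <= eta) -> `|f x - f y| <= e.
have H : \forall eta \near (0 : R)^'+, @unit_cube R d `<=` Q eta.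
  apply: ((compact_near_coveringP _).1 (@compact_unit_cube R d)) => x xc.
  have /cvgrPdist_lt/(_ _ e20) := fc x xc; rewrite near_withinE => /nbhs_ballP[r /= r0 fr].
  have r20 : 0 < r / 2 by rewrite divr_gt0.
  exists (ball x (r / 2), [set eta | eta < r / 2]).
    by split; [exact: nbhsx_ballx|exact: nbhs_right_lt].
  move=> [x' eta] /= [xx' er] x'c y yc x'y.
  have fx' : `|f x - f x'| < e / 2.
    by apply: fr => //; apply: le_ball xx'; lra.
  have fy : `|f x - f y| < e / 2.
    apply: fr => //; split=> // i j; rewrite /ball /= (ord1 i).
    have := xx'.2 i j; rewrite /ball /= (ord1 i) => xx'j.
    rewrite (_ : _ - _ = (x ord0 j - x' ord0 j) + (x' ord0 j - y ord0 j)); last by ring.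
    rewrite (le_lt_trans (ler_normD _ _)) // [ltRHS]splitr ltrD // (le_lt_trans (x'y j)) //.
  rewrite (_ : _ - _ = (f x - f y) - (f x - f x')); last by ring.
  by rewrite (le_trans (ler_normB _ _)) // [leRHS]splitr lerD // ltW.
have [eta [/= eta0 {}H]] := filter_ex (filterI (nbhs_right_gt (0 : R)) H).
by exists eta => // x y xc yc xy; exact: H.
Qed.

Lemma cube_continuous_bounded {R : realType} (d : nat) (f : 'rV[R]_d -> R) :
  {within @unit_cube R d, continuous f} ->
  exists M : R, forall x, unit_cube x -> `|f x| <= M.
Proof.
move=> /continuous_compact /(_ (@compact_unit_cube R d)) /compact_bounded.
move=> [M [_ /(_ (M + 1))]]; rewrite ltrDl => /(_ ltr01) H.
by exists (M + 1) => x xc; apply: H; exists x.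
Qed.

(** * Smooth functions *)

(** Differentiability [n + 1] times. Derivatives are existential witnesses, so closure properties
    follow by induction without computing iterated derivatives. *)
Fixpoint ndiff {R : realType} (n : nat) (f : R -> R) : Prop :=
  exists f' : R -> R, (forall x : R, is_derive x (1 : R) f (f' x)) /\
    (if n is k.+1 then ndiff k f' else True).

Lemma ndiff_smooth {R : realType} (f : R -> R) : (forall n, ndiff n f) -> smooth f.
Proof.
move=> fn n x; have := fn n; elim: n f {fn} => [|n IH] f.
  by move=> [f' [/(_ x)]].
move=> [f' [ff' /IH]]; rewrite derive1Sn.
suff -> : derive1 f = f' by [].
by apply/funext => y; rewrite derive1E (derive_val (is_derive := ff' y)).
Qed.

Lemma ndiffW {R : realType} (n : nat) (f : R -> R) : ndiff n.+1 f -> ndiff n f.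
Proof.
elim: n f => [|n IH] f; first by move=> [f' [? _]]; exists f'.
by move=> [f' [? /IH ?]]; exists f'.
Qed.

Lemma ndiff_cst {R : realType} (n : nat) (c : R) : ndiff n (fun=> c).
Proof.
by elim: n c => [|n IH] c; exists (fun=> 0); split=> // x; exact: is_derive_cst.
Qed.

Lemma ndiffD {R : realType} (n : nat) (f g : R -> R) :
  ndiff n f -> ndiff n g -> ndiff n (fun x => f x + g x).
Proof.
elim: n f g => [|n IH] f g [f' [ff fn]] [g' [gg gn]];
  exists (fun x => f' x + g' x).
  by split=> // x; exact: is_deriveD (ff x) (gg x).
by split=> [x|]; [exact: is_deriveD (ff x) (gg x)|exact: IH].
Qed.

Lemma ndiffM {R : realType} (n : nat) (f g : R -> R) :
  ndiff n f -> ndiff n g -> ndiff n (fun x => f x * g x).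
Proof.
elim: n f g => [|n IH] f g fn gn; have [f' [ff f'n]] := fn; have [g' [gg g'n]] := gn.
  exists (fun x => f x * g' x + g x * f' x); split=> // x.
  exact: is_deriveM (ff x) (gg x).
exists (fun x => f x * g' x + g x * f' x); split=> [x|].
  exact: is_deriveM (ff x) (gg x).
by apply: ndiffD; apply: IH => //; exact: ndiffW.
Qed.

Lemma ndiff_comp {R : realType} (n : nat) (f g : R -> R) :
  ndiff n f -> ndiff n g -> ndiff n (fun x => f (g x)).
Proof.
elim: n f g => [|n IH] f g [f' [ff f'n]] gn; have [g' [gg g'n]] := gn;
  exists (fun x => f' (g x) * g' x).
  by split=> // x; exact: is_derive1_comp (ff (g x)) (gg x).
split=> [x|]; first exact: is_derive1_comp (ff (g x)) (gg x).
by apply: ndiffM => //; apply: IH => //; exact: ndiffW.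
Qed.

Lemma ndiff_affine {R : realType} (n : nat) (a b : R) : ndiff n (fun x => a * x + b).
Proof.
apply: ndiffD; last exact: ndiff_cst.
apply: ndiffM; first exact: ndiff_cst.
have did (x : R) : is_derive x (1 : R) (fun y => y) (1 : R) by exact: is_derive_id.
by case: n => [|n]; exists (fun=> 1); split=> //; exact: ndiff_cst.
Qed.

Lemma ndiff_sum {R : realType} (n : nat) (I : finType) (f : I -> R -> R) :
  (forall i, ndiff n (f i)) -> ndiff n (fun x => \sum_i f i x).
Proof.
move=> fn; elim: (index_enum I) => [|i s IH].
  by under eq_fun do rewrite big_nil; exact: ndiff_cst.
by under eq_fun do rewrite big_cons; exact: ndiffD.
Qed.

(** Serves the series of waves, a finite sum on each half-line. The derivative again has local
    representatives, so the induction goes through. *)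
Lemma ndiff_local {R : realType} (n : nat) (f : R -> R) :
  (forall M, exists2 g, ndiff n g & forall x, x < M -> f x = g x) -> ndiff n f.
Proof.
pose loc k (h : R -> R) :=
  forall M, exists2 g, ndiff k g & forall x : R, x < M -> h x = g x.
have D k h : loc k h ->
    forall M, exists2 f' : R -> R, (if k is j.+1 then ndiff j f' else True) &
      forall x : R, x < M -> is_derive x (1 : R) h (f' x).
  move=> H M; have [g + fg] := H M.
  case: k {H} => [|k] [g' [gg gn]]; exists g' => // x xM;
    (apply: near_eq_is_derive (gg x); near=> y; rewrite fg //; near: y; exact: lt_nbhsl).
have D1 k h (H : loc k h) : forall x : R, is_derive x (1 : R) h (derive1 h x).
  move=> x; have [f' _ /(_ x)] := D k h H (x + 1).
  rewrite ltrDl => /(_ ltr01) ff'.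
  by rewrite derive1E (derive_val (is_derive := ff')).
elim: n f => [|n IH] f H; exists (derive1 f); split=> //; try exact: D1 H.
apply: IH => M; have [f' f'n ff'] := D _ _ H M; exists f' => // x xM.
by rewrite derive1E; have /= -> := derive_val (is_derive := ff' x xM).
Unshelve. all: by end_near. Qed.

(** The difference quotient at 0 is at most [C |h|]. *)
Lemma is_derive0_quadratic {R : realType} (f : R -> R) (C : R) :
  f 0 = 0 -> (forall x, `|f x| <= C * x ^+ 2) -> is_derive (0 : R) (1 : R) f 0.
Proof.
move=> f0 fC.
have C0 : 0 <= C by have := fC 1; rewrite expr1n mulr1; apply: le_trans.
have lim : h^-1 *: ((f \o shift 0) (h *: 1) - f 0) @[h --> 0^'] --> (0 : R).
  apply/cvgrPdist_le => e e0; near=> h.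
  have h0 : h != 0 by near: h; exact: nbhs_dnbhs_neq.
  rewrite sub0r normrN /= f0 subr0 addr0 normrZ normfV.
  rewrite mulrC ler_pdivrMr ?normr_gt0 // [h *: 1]mulr1.
  rewrite (le_trans (fC h)) // -[h ^+ 2]ger0_norm ?sqr_ge0 // normrX expr2.
  rewrite mulrA ler_wpM2r // (@le_trans _ _ ((C + 1) * `|h|)) ?ler_wpM2r ?lerDl //.
  rewrite mulrC -ler_pdivlMr ?ltr_wpDl //; near: h; apply: dnbhs0_le.
  by rewrite divr_gt0 // ltr_wpDl.
split; last by rewrite /derive; apply/cvg_lim.
by apply/cvg_ex; exists 0.
Unshelve. all: by end_near. Qed.

(* The functions [P(1/x) exp(-1/x)], extended by [0], are closed under
   differentiation, whence their smoothness. *)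
Definition flat {R : realType} (p : {poly R}) (x : R) : R :=
  if 0 < x then p.[x^-1] * expR (- x^-1) else 0.

(** Termwise, [t ^ i / i!] is at most [exp t]. *)
Lemma horner_expR_bounded {R : realType} (p : {poly R}) :
  exists2 C : R, 0 <= C & forall t, 0 <= t -> `|p.[t]| <= C * expR t.
Proof.
exists (\sum_(i < size p) `|p`_i| * i`!%:R) => [|t t0].
  by apply: sumr_ge0 => i _; rewrite mulr_ge0.
rewrite horner_coef mulr_suml (le_trans (ler_norm_sum _ _ _)) //.
apply: ler_sum => i _; rewrite normrM -mulrA ler_wpM2l // ger0_norm ?exprn_ge0 //.
have fi : 0 < i`!%:R :> R by rewrite ltr0n fact_gt0.
rewrite mulrC -ler_pdivrMr //; case: (nat_of_ord i) => [|k].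
  by rewrite expr0 divr1; have := expR_ge1Dx t; lra.
by have := expR_ge1Dxn k t0; lra.
Qed.

Lemma is_derive_flat {R : realType} (p : {poly R}) (x : R) :
  is_derive x (1 : R) (flat p) (flat ('X^2 * (p - p^`())) x).
Proof.
have [x0|x0|->] := ltgtP x 0.
- rewrite {2}/flat ltNge (ltW x0) /=; apply: near_eq_is_derive (is_derive_cst 0 x 1).
  near=> y; rewrite /flat ltNge ltW //; near: y; exact: lt_nbhsl.
- rewrite {2}/flat x0.
  have dinv : is_derive x (1 : R) (fun y : R => y^-1) (- x ^- 2).
    have := @is_deriveV R id x 1 1 (lt0r_neq0 x0) (is_derive_id x (1 : R)).
    by rewrite /GRing.scale /= mulr1.
  have dp := is_derive1_comp (is_derive_poly p x^-1) dinv.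
  have de := @is_derive1_comp R expR (fun y => - y^-1) x _ _ (is_derive_expR _) (is_deriveN dinv).
  have := is_deriveM dp de; rewrite /= => H.
  apply: near_eq_is_derive (is_derive_eq H _); last first.
    rewrite /GRing.scale /= !(hornerM, hornerX, hornerD, hornerN) -exprVn; ring.
    by near=> y; rewrite /flat ifT //; near: y; exact: lt_nbhsr.
(* At the origin, the exponential bound for [p * 'X^2] at [1 / y] becomes
   [|flat p y| <= C y ^ 2]. *)
- rewrite {2}/flat ltxx; have [C C0 pC] := horner_expR_bounded (p * 'X^2).
  apply: (is_derive0_quadratic _ C); first by rewrite /flat ltxx.
  move=> y; rewrite /flat; case: ifPn => [y0|_]; last first.
    by rewrite normr0 mulr_ge0 // sqr_ge0.
  have yV0 : 0 < y^-1 by rewrite invr_gt0.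
  have := pC _ (ltW yV0); rewrite hornerM hornerXn normrM [`|_ ^+ 2|]ger0_norm ?sqr_ge0 //.
  rewrite exprVn ler_pdivrMr ?exprn_gt0 // => H.
  rewrite normrM [`|expR _|]ger0_norm ?expR_ge0 // expRN ler_pdivrMr ?expR_gt0 //.
  by rewrite mulrAC.
Unshelve. all: by end_near. Qed.

Lemma ndiff_flat {R : realType} (n : nat) (p : {poly R}) : ndiff n (flat p).
Proof.
by elim: n p => [|n IH] p; exists (flat ('X^2 * (p - p^`()))); split=> // x;
  exact: is_derive_flat.
Qed.

(** The classical [exp (-1/x)] extended by 0; it supplies both the smooth ramp and the left branch
    of the activation function. *)
Definition psi {R : realType} (x : R) : R := flat 1 x.

Lemma psi_le0 {R : realType} (x : R) : x <= 0 -> psi x = 0.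
Proof. by rewrite /psi /flat ltNge => ->. Qed.

Lemma psi_gt0E {R : realType} (x : R) : 0 < x -> psi x = expR (- x^-1).
Proof. by rewrite /psi /flat => ->; rewrite hornerC mul1r. Qed.

Lemma psi_gt0 {R : realType} (x : R) : 0 < x -> 0 < psi x.
Proof. by move=> x0; rewrite psi_gt0E // expR_gt0. Qed.

Lemma psi_lt {R : realType} (x y : R) : x < y -> 0 < y -> psi x < psi y.
Proof.
move=> xy y0; have [/psi_le0->|x0] := leP x 0; first exact: psi_gt0.
by rewrite !psi_gt0E // ltr_expR ltrN2 ltf_pV2.
Qed.

Lemma psi_homo {R : realType} : {homo @psi R : x y / x <= y}.
Proof.
move=> x y; rewrite le_eqVlt => /predU1P[->//|xy].
have [y0|y0] := leP y 0; last exact/ltW/psi_lt.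
by rewrite !psi_le0 // (le_trans (ltW xy)).
Qed.

Lemma smooth_ramp_exists {R : realType} :
  exists2 S : R -> R, ramp 0 S & forall n, ndiff n S.
Proof.
have b0 : 0 < psi (psi 1) :> R by rewrite !psi_gt0.
(* Nesting [psi] keeps the denominator constant: the inner argument is [psi 1] for [x <= 0] and
   nonpositive for [x >= 1]. *)
exists (fun x : R => 1 - psi (psi 1 - psi x) / psi (psi 1)).
  split=> [x y xy|t t0|t t1].
  - by rewrite lerD2l lerN2 ler_pM2r ?invr_gt0 // psi_homo // lerD2l lerN2 psi_homo.
  - by rewrite (psi_le0 _ t0) subr0 divff ?subrr // gt_eqF.
  - by rewrite [psi (_ - _)]psi_le0 ?mul0r ?subr0 // subr_le0 psi_homo.
move=> n.
have nN (f : R -> R) a b : ndiff n f -> ndiff n (fun x => a * f x + b).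
  exact: ndiff_comp (ndiff_affine n a b).
rewrite (_ : (fun x => _) =
    fun x => - (psi (psi 1))^-1 * psi (-1 * psi x + psi 1) + 1); last first.
  by apply/funext => x; rewrite mulN1r [- psi x + _]addrC mulNr [RHS]addrC [_^-1 * _]mulrC.
have /nN H := ndiff_comp n psi _ (ndiff_flat n 1) (nN _ (-1) (psi 1) (ndiff_flat n 1)).
exact: H.
Qed.

(** * The activation function *)

Section Sigma.
Context {R : realType} (alpha lam : R) (S : R -> R).
Context (lam_gt0 : 0 < lam) (rS : ramp 0 S) (dS : forall n, ndiff n S).

(** The countable dense family: smooth interpolants of finite rational sequences. With plateaux of
    length 0, [N] nodes occupy [[0, N + 1]], whence the factor compressing to the unit interval. *)
Definition bump (c : seq rat) (t : R) : R :=
  interp S (size c) (fun k => ratr c`_k) ((size c).+1%:R * t).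

Let bump_norm (c : seq rat) : R := \sum_(k < size c) `|ratr c`_k|.

Let bump_norm_ge0 c : 0 <= bump_norm c. Proof. exact: sumr_ge0. Qed.

Lemma bump_bound c t : `|bump c t| <= bump_norm c.
Proof.
apply: (interp_bound _ _ _ _ rS) => // k kc.
rewrite /bump_norm (bigD1 (Ordinal kc)) //= lerDl; exact: sumr_ge0.
Qed.

Lemma bump_out c t : t <= 0 \/ 1 <= t -> bump c t = 0.
Proof.
move=> t01; apply: (interp_out _ _ _ _ rS).
case: t01 => [t0|t1]; [left|right]; first by rewrite pmulr_rle0.
by rewrite natr1 ler_peMr.
Qed.

Lemma ndiff_bump n c : ndiff n (bump c).
Proof.
apply: ndiff_sum => k; apply: (ndiffM _ (fun=> _)); first exact: ndiff_cst.
have nS a b : ndiff n (fun x => S (a * x + b)).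
  by apply: (ndiff_comp _ S) => //; exact: ndiff_affine.
apply: ndiffD; first exact: nS.
have -> : (fun x : R => - S ((size c).+1%:R * x - k.+1%:R)) =
  (fun x => -1 * S ((size c).+1%:R * x - k.+1%:R) + 0).
  by apply/funext => x; rewrite mulN1r addr0.
exact: (ndiff_comp _ (fun y => -1 * y + 0)) (ndiff_affine _ _ _) (nS _ _).
Qed.

Let code n : seq rat := odflt [::] (unpickle n).

(* The factor [n.+1] makes the waves die out at [+oo]. *)
Definition height (n : nat) : R := lam / 2 / (n.+1%:R * (1 + bump_norm (code n))).

Lemma height_gt0 n : 0 < height n.
Proof. by rewrite !divr_gt0 // mulr_gt0 // ltr_pwDl. Qed.

Definition waves (N : nat) (x : R) : R :=
  \sum_(n < N) height n * bump (code n) (x - alpha - n%:R).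

(** A series in disguise: bumps of index at least [x - alpha] vanish at [x], so a partial sum
    depending on [x] is enough. *)
Definition wave (x : R) : R := waves (Num.truncn (x - alpha)).+1 x.

Lemma waves_stable N M x : (N <= M)%N -> x - alpha <= N%:R -> waves M x = waves N x.
Proof.
move=> NM xN; rewrite /waves -(subnKC NM) big_split_ord /= [X in _ + X]big1 ?addr0 // => n _.
by rewrite bump_out ?mulr0 //; left; rewrite natrD; have : 0 <= n%:R :> R by []; lra.
Qed.

Lemma wavesE N x : x - alpha <= N%:R -> wave x = waves N x.
Proof.
move=> xN; rewrite /wave; set M := _.+1.
have xM : x - alpha <= M%:R by apply/ltW; exact: truncnS_gt.
by have [NM|MN] := leqP N M; [|symmetry]; apply: waves_stable; rewrite // ltnW.
Qed.

Lemma wave_eq n x : n%:R <= x - alpha <= n.+1%:R ->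
  wave x = height n * bump (code n) (x - alpha - n%:R).
Proof.
move=> /andP[x1 x2]; rewrite (wavesE _ _ x2) /waves big_ord_recr /= big1 ?add0r // => j _.
rewrite bump_out ?mulr0 //; right; rewrite lerBrDr (le_trans _ x1) //.
by rewrite addrC natr1 ler_nat.
Qed.

Lemma wave_le0 x : x <= alpha -> wave x = 0.
Proof. by move=> x0; rewrite (wavesE 0) ?subr_le0 // /waves big_ord0. Qed.

Lemma wave_bound n x : n%:R <= x - alpha <= n.+1%:R -> `|wave x| <= lam / 2 / n.+1%:R.
Proof.
move=> /wave_eq ->; rewrite normrM gtr0_norm ?height_gt0 //.
have -> : height n = lam / 2 / n.+1%:R * (1 + bump_norm (code n))^-1.
  by rewrite /height invfM mulrA.
rewrite -(mulrA _ _ `|_|) ler_piMr ?divr_ge0 ?(ltW lam_gt0) // mulrC.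
rewrite ler_pdivrMr ?ltr_pwDl // mul1r.
by rewrite (le_trans (bump_bound _ _)) // lerDr.
Qed.

Lemma wave_decay x : alpha < x -> `|wave x| <= lam / 2 / (x - alpha).
Proof.
move=> ax; have x0 : 0 < x - alpha by rewrite subr_gt0.
have /andP[x1 x2] := truncn_itv (ltW x0).
apply: le_trans (wave_bound (Num.truncn (x - alpha)) _ _) _; first by rewrite x1 ltW.
by rewrite ler_wpM2l ?divr_ge0 ?(ltW lam_gt0) // lef_pV2 ?posrE // ltW.
Qed.

Lemma wave_small x : `|wave x| <= lam / 2.
Proof.
have l0 := ltW lam_gt0.
have [/wave_le0->|x0] := leP x alpha; first by rewrite normr0 divr_ge0.
have /truncn_itv/andP[x1 x2] : 0 <= x - alpha by rewrite subr_ge0 ltW.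
apply: le_trans (wave_bound (Num.truncn (x - alpha)) _ _) _; first by rewrite x1 ltW.
by rewrite ler_pdivrMr // ler_peMr ?divr_ge0 // ler1n.
Qed.

(** Left of [alpha] this is [1 - exp (-1 / (alpha - x))], rising from 0 to 1; from [alpha] on it is
    1 plus the wave. *)
Definition sigma (x : R) : R := 1 - psi (alpha - x) + wave x.

Lemma sigma_left x : x <= alpha -> sigma x = 1 - psi (alpha - x).
Proof. by move=> /wave_le0; rewrite /sigma => ->; rewrite addr0. Qed.

Lemma sigma_right x : alpha <= x -> sigma x = 1 + wave x.
Proof. by move=> ax; rewrite /sigma psi_le0 ?subr0 // subr_le0. Qed.

Lemma smooth_sigma : smooth sigma.
Proof.
apply: ndiff_smooth => n; apply: ndiffD.
  have -> : (fun x => 1 - psi (alpha - x)) = (fun x => -1 * psi (-1 * x + alpha) + 1).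
    by apply/funext => x; rewrite !mulN1r addrC [alpha - x]addrC.
  apply: (ndiff_comp _ (fun y => -1 * y + 1)); first exact: ndiff_affine.
  by apply: (ndiff_comp _ psi); [exact: ndiff_flat|exact: ndiff_affine].
apply: ndiff_local => M; exists (waves (Num.truncn (M - alpha)).+1).
  apply: ndiff_sum => k; apply: (ndiffM _ (fun=> _)); first exact: ndiff_cst.
  have -> : (fun x => bump (code k) (x - alpha - k%:R)) =
      fun x => bump (code k) (1 * x + (- alpha - k%:R)).
    by apply/funext => x; rewrite mul1r addrA.
  by apply: (ndiff_comp _ (bump (code k))); [exact: ndiff_bump|exact: ndiff_affine].
by move=> x xM; apply: wavesE; rewrite ltW // (lt_trans _ (truncnS_gt _)) // ltrD2r.
Qed.

Lemma sigmoidal_sigma : sigmoidal sigma.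
Proof.
split; apply/cvgrPdist_le => e e0; near=> x.
  have eV : 0 < e^-1 by rewrite invr_gt0.
  have xe : x <= alpha - e^-1 by near: x; apply: nbhs_ninfty_le; rewrite num_real.
  have y0 : 0 < alpha - x by lra.
  have xa : x <= alpha by rewrite -subr_ge0 ltW.
  rewrite (sigma_left _ xa) (psi_gt0E _ y0).
  have h1 := expR_ge1Dx (- (alpha - x)^-1).
  have h2 : expR (- (alpha - x)^-1) <= 1.
    by rewrite -expR0 ler_expR oppr_le0 invr_ge0 ltW.
  have h3 : (alpha - x)^-1 <= e by rewrite -[e]invrK lef_pV2 ?posrE //; lra.
  by rewrite sub0r normrN ger0_norm; lra.
have le0 : 0 < lam / 2 / e by rewrite !divr_gt0.
have xe : alpha + lam / 2 / e <= x by near: x; apply: nbhs_pinfty_ge; rewrite num_real.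
have ax : alpha < x by lra.
rewrite (sigma_right _ (ltW ax)) opprD addrA subrr sub0r normrN.
rewrite (le_trans (wave_decay _ ax)) // ler_pdivrMr ?subr_gt0 // [e * _]mulrC.
by rewrite -ler_pdivrMr //; lra.
Unshelve. all: by end_near. Qed.

Lemma sigma_increasing : strictly_increasing_on `]-oo, alpha[ sigma.
Proof.
move=> x y; rewrite !in_itv /= => xa ya xy.
by rewrite !sigma_left ?ltW // ltrD2l ltrN2 psi_lt ?ltrD2l ?ltrN2 // subr_gt0.
Qed.

Lemma sigma_almost_increasing : approx_strictly_increasing_on lam `[alpha, +oo[ sigma.
Proof.
have l0 : 0 < lam / 2 by rewrite divr_gt0.
(* A strictly increasing function within [lam / 2] of 1; the wave uses the other half of [lam]. *)
exists (fun x => 1 - lam / 2 / (1 + x - alpha)); split=> [x y|x]; rewrite !in_itv /= !andbT.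
  move=> xa ya xy; rewrite ltrD2l ltrN2 ltr_pM2l // ltf_pV2 ?posrE; lra.
move=> ax; rewrite sigma_right // (_ : _ - _ = wave x + lam / 2 / (1 + x - alpha)); last first.
  by rewrite opprB addrC addrA subrK addrC.
rewrite (le_trans (ler_normD _ _)) // [leRHS]splitr lerD ?wave_small //.
rewrite ger0_norm; last by rewrite divr_ge0 ?(ltW l0) //; lra.
by rewrite ler_pdivrMr ?ler_peMr ?(ltW l0) //; lra.
Qed.

Lemma sigma_alpha : sigma alpha = 1.
Proof. by rewrite sigma_right // wave_le0 // addr0. Qed.

(** Rational approximations of samples of [h] form a sequence whose code [n] locates an interval
    where the activation function reproduces their interpolant, up to affine changes. *)
Lemma sigma_universal (h : R -> R) (A B e : R) : lip h -> A < B -> 0 < e ->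
  exists a b s g : R, forall x, A <= x <= B ->
    `|h x - (a + b * sigma (s * x - g))| <= e.
Proof.
move=> [L L0 hL] AB e0; have AB0 : 0 < B - A by rewrite subr_gt0.
have e20 : 0 < e / 2 by rewrite divr_gt0.
(* With mesh [(B - A) / D], active samples lie within two mesh lengths of the point, costing at most
   [e / 2]; rational rounding costs the rest. *)
pose M := Num.truncn (2 * L * (B - A) / (e / 2)).
pose D : R := M.+1%:R.
have D0 : 0 < D by rewrite ltr0n.
have MD : 2 * L * (B - A) <= (e / 2) * D.
  by rewrite [e / 2 * D]mulrC -ler_pdivrMr //; apply/ltW; exact: truncnS_gt.
pose X (tau : R) := A + (B - A) * (tau - 1) / D.
have /choice[r rP] (k : nat) : exists r : rat, `|ratr r - h (X k%:R)| <= e / 2.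
  have : h (X k%:R) < h (X k%:R) + e / 2 by rewrite ltrDl.
  move=> /rat_in_itvoo[r]; rewrite in_itv /= => /andP[r1 r2]; exists r.
  by rewrite ger0_norm; lra.
pose c := mkseq r M.+2; pose n := pickle c.
have cn : code n = c by rewrite /code /n pickleK.
have sc : size c = M.+2 by rewrite size_mkseq.
pose tau (x : R) := D * (x - A) / (B - A) + 1.
have tauP x : A <= x <= B -> 1 <= tau x <= M.+2%:R.
  move=> /andP[Ax xB]; rewrite /tau lerDr divr_ge0 ?mulr_ge0 ?subr_ge0 ?(ltW D0) ?(ltW AB) //=.
  by rewrite -[M.+2%:R]natr1 lerD2r ler_pdivrMr // ler_wpM2l ?(ltW D0) // lerD2r.
have near_h x : A <= x <= B ->
    `|interp S M.+2 (fun k => ratr c`_k) (tau x) - h x| <= e.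
  move=> /tauP txP; apply: (interp_near _ _ _ _ rS); rewrite ?addr0 ?(ltW e0) //.
  move=> k kM; rewrite addr0 => /andP[k1 k2]; rewrite nth_mkseq //.
  rewrite -[ratr _](subrK (h (X k%:R))) -addrA (le_trans (ler_normD _ _)) //.
  rewrite [leRHS]splitr lerD // (le_trans (hL _ _)) //.
  have -> : X k%:R - x = (B - A) / D * (k%:R - tau x).
    by rewrite /X /tau; field; rewrite !gt_eqF.
  rewrite normrM gtr0_norm ?divr_gt0 // (@le_trans _ _ (2 * L * (B - A) / D)) //; last first.
    by rewrite ler_pdivrMr.
  rewrite [leRHS](_ : _ = L * ((B - A) / D * 2)); last by ring.
  rewrite !ler_wpM2l ?divr_ge0 ?(ltW AB0) ?(ltW D0) //.
  by rewrite ler_norml; apply/andP; split; lra.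
(* The inner affine map sends [x] to [alpha + n + tau x / (M + 3)], where [M + 3] is the compression
   factor of the bump; the outer one removes the 1 and the height. *)
exists (- (height n)^-1), (height n)^-1,
  (D / (B - A) / M.+3%:R), (- (alpha + n%:R + (1 - D * A / (B - A)) / M.+3%:R)) => x xAB.
rewrite distrC; set z := _ - - _; have /andP[t1 t2] := tauP _ xAB.
have M0 : 0 < M.+3%:R :> R by rewrite ltr0n.
have Ez : z - alpha = n%:R + tau x / M.+3%:R.
  by rewrite /z /tau; field; rewrite !gt_eqF.
have tM0 : 0 <= tau x / M.+3%:R by rewrite divr_ge0 // (le_trans ler01).
have tM1 : tau x / M.+3%:R <= 1.
  by rewrite ler_pdivrMr // mul1r (le_trans t2) // ler_nat.
have n0 : 0 <= n%:R :> R by [].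
rewrite sigma_right; last by rewrite -subr_ge0 Ez addr_ge0.
rewrite (wave_eq n); last by rewrite Ez -[n.+1%:R]natr1 lerDl tM0 lerD2l.
rewrite Ez [_ + _ - n%:R]addrAC subrr add0r cn /bump sc [M.+3%:R * _]mulrC.
rewrite divfK ?gt_eqF // mulrDr mulr1 addKr mulKf ?gt_eqF ?height_gt0 //.
exact: near_h.
Qed.

End Sigma.

(** * Assembly of the two-layer network *)

Lemma lip_bounded {R : realType} (f : R -> R) : lip f ->
  exists C : R, forall x, 0 <= x <= 1 -> `|f x| <= C.
Proof.
move=> [L L0 fL]; exists (`|f 0| + L) => x /andP[x0 x1].
rewrite -[f x](subrK (f 0)) addrC (le_trans (ler_normD _ _)) // lerD2l.
by rewrite (le_trans (fL _ _)) // subr0 ger0_norm // ler_piMr.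
Qed.

Lemma dotp_scale_delta {R : realType} (d : nat) (s : R) (q : 'I_d) (x : 'rV[R]_d) :
  dotp (s *: delta_mx ord0 q) x = s * x ord0 q.
Proof.
rewrite /dotp (bigD1 q) //= !mxE !eqxx mulr1 big1 ?addr0 // => i iq.
by rewrite !mxE (negPf iq) andbF mulr0 mul0r.
Qed.

Theorem theorem5p9 (R : realType) (alpha lam : R)
    (alpha_gt0 : 0 < alpha) (lam_gt0 : 0 < lam) :
  exists sigma : R -> R,
    sigmoidal sigma /\
    smooth sigma /\
    strictly_increasing_on `]-oo, alpha[ sigma /\
    approx_strictly_increasing_on lam `[alpha, +oo[ sigma /\
    forall (d : nat) (f : 'rV[R]_d -> R) (eps : R),
      (0 < d)%N ->
      {within @unit_cube R d, continuous f} ->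
      0 < eps ->
      exists (a gamma : 'I_(2 * d + 2) -> R)
             (c theta : 'I_(2 * d + 2) -> 'I_d -> R)
             (w : 'I_(2 * d + 2) -> 'I_d -> 'rV[R]_d),
        forall x : 'rV[R]_d, unit_cube x ->
          `| f x - \sum_(p < 2 * d + 2)
                a p * sigma (\sum_(q < d)
                   c p q * sigma (dotp (w p q) x - theta p q) - gamma p) |
            < eps.
Proof.
have [S rS dS] := @smooth_ramp_exists R.
pose s : R -> R := sigma alpha lam S; exists s.
split; first exact: sigmoidal_sigma.
split; first exact: smooth_sigma.
split; first exact: sigma_increasing.
split; first exact: sigma_almost_increasing.
move=> d f eps _ fc eps0.
(* From here on only universality and the value 1 at [alpha] are used of the activation function. *)
have s_univ h A B e := @sigma_universal R alpha lam S lam_gt0 rS h A B e.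
have s_alpha := @sigma_alpha R alpha lam S rS.
rewrite -/s in s_univ s_alpha; clearbody s.
have [M fM] := cube_continuous_bounded _ _ fc.
have e40 : 0 < eps / 4 by rewrite divr_gt0.
have [phi [g [phiL gL fphi]]] :=
  kolmogorov_approx _ _ _ _ (cube_continuous_ucont _ _ fc) fM e40.
have [delta delta0 gdelta] := superposition_near _ d _ _ gL e40.
have /choice[C CP] (pq : 'I_(2 * d).+1 * 'I_d) := lip_bounded _ (phiL pq.1 pq.2).
(* [delta] protects the superposition; 1 keeps the replaced inner sums within the bound [B p], on
   which the outer functions are then approximated. *)
have e0 : 0 < Num.min delta 1 by rewrite lt_min delta0 ltr01.
have /choice[u uP] (pq : 'I_(2 * d).+1 * 'I_d) : exists u : R * R * R * R,
    forall x, 0 <= x <= 1 -> `|phi pq.1 pq.2 x -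
      (u.1.1.1 + u.1.1.2 * s (u.1.2 * x - u.2))| <= Num.min delta 1.
  have [a [b [c [t H]]]] := s_univ _ 0 1 _ (phiL pq.1 pq.2) ltr01 e0.
  by exists (a, b, c, t).
pose phi' p q x := (u (p, q)).1.1.1 + (u (p, q)).1.1.2 * s ((u (p, q)).1.2 * x - (u (p, q)).2).
pose B p := \sum_q (C (p, q) + 1).
have phi'B p (x : 'rV[R]_d) : unit_cube x -> `|\sum_q phi' p q (x ord0 q)| <= B p.
  move=> xc; rewrite (le_trans (ler_norm_sum _ _ _)) // ler_sum // => q _.
  rewrite -[phi' _ _ _](subrK (phi p q (x ord0 q))) addrC.
  rewrite (le_trans (ler_normD _ _)) // lerD ?(CP (p, q)) // distrC.
  by rewrite (le_trans (uP (p, q) _ (xc q))) // ge_min lexx orbT.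
have eP : 0 < eps / 4 / (2 * d).+1%:R by rewrite divr_gt0.
have /choice[v vP] (p : 'I_(2 * d).+1) : exists v : R * R * R * R,
    forall x, `|x| <= B p -> `|g p x -
      (v.1.1.1 + v.1.1.2 * s (v.1.2 * x - v.2))| <= eps / 4 / (2 * d).+1%:R.
  have AB : - (`|B p| + 1) < `|B p| + 1 by have := normr_ge0 (B p); lra.
  have [a [b [c [t H]]]] := s_univ _ _ _ _ (gL p) AB eP.
  exists (a, b, c, t) => x xB; apply: H; rewrite -ler_norml (le_trans xB) //.
  by rewrite (le_trans (ler_norm _)) // lerDl.
rewrite addn2.
(* Index 0 is the extra unit; the others carry the superposition. *)
pose ext (T : Type) (x0 : T) (h : 'I_(2 * d).+1 -> T) (p : 'I_(2 * d).+2) : T :=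
  oapp h x0 (unlift ord0 p).
have ext0 T x0 h : @ext T x0 h ord0 = x0 by rewrite /ext unlift_none.
have extS T x0 h j : @ext T x0 h (lift ord0 j) = h j by rewrite /ext liftK.
(* The extra unit has zero inner coefficients and threshold [- alpha], so it outputs 1 and
   contributes the sum of the outer constants. The other thresholds absorb the inner constants,
   scaled by the outer slope. *)
exists (ext _ (\sum_p (v p).1.1.1) (fun p => (v p).1.1.2)),
  (ext _ (- alpha) (fun p => (v p).2 - (v p).1.2 * \sum_q (u (p, q)).1.1.1)),
  (ext _ (fun=> 0) (fun p q => (v p).1.2 * (u (p, q)).1.1.2)),
  (ext _ (fun=> 0) (fun p q => (u (p, q)).2)),
  (ext _ (fun=> 0) (fun p q => (u (p, q)).1.2 *: delta_mx ord0 q)) => x xc.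
rewrite big_ord_recl !ext0 [X in s (X - _)]big1 => [|q _]; last by rewrite mul0r.
rewrite sub0r opprK s_alpha mulr1.
rewrite [X in _ - (_ + X)](_ : _ = \sum_p (v p).1.1.2 *
    s ((v p).1.2 * \sum_q phi' p q (x ord0 q) - (v p).2)); last first.
  apply: eq_bigr => p _; rewrite !extS; congr (_ * s _).
  under eq_bigr do rewrite dotp_scale_delta -mulrA.
  by rewrite -mulr_sumr /phi' big_split /=; ring.
rewrite -big_split /=.
have H1 := fphi x xc.
have H2 : `|superposition phi g x - \sum_p g p (\sum_q phi' p q (x ord0 q))| <= eps / 4.
  apply: (gdelta (fun p q => phi p q (x ord0 q)) (fun p q => phi' p q (x ord0 q))) => p q.
  by rewrite (le_trans (uP (p, q) _ (xc q))) // ge_min lexx.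
have H3 : `|\sum_p g p (\sum_q phi' p q (x ord0 q)) - \sum_p ((v p).1.1.1 + (v p).1.1.2 *
    s ((v p).1.2 * \sum_q phi' p q (x ord0 q) - (v p).2))| <= eps / 4.
  rewrite -sumrB (le_trans (ler_norm_sum _ _ _)) //.
  rewrite (le_trans (ler_sum _ (fun p _ => vP p _ (phi'B p x xc)))) //.
  by rewrite sumr_const card_ord -[_ *+ _]mulr_natr divfK.
move: H1 H2 H3; set F1 := superposition _ _ _; set F2 := \sum_p g p _; set F3 := \sum_p (_ + _).
(* Three errors of at most [eps / 4]: superposition, inner replacement, outer replacement. *)
move=> H1 H2 H3; rewrite (_ : f x - F3 = (f x - F1) + (F1 - F2) + (F2 - F3)); last by ring.
have := ler_normD (f x - F1 + (F1 - F2)) (F2 - F3); have := ler_normD (f x - F1) (F1 - F2).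
lra.
Qed.
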